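(* Let $(m_1,m_2,m_3,t_1,t_2)\in \mathbb{N}^5$ be a solution to the Diophantine equation $$F_{m_1} + F_{m_2} + F_{m_3} = 2^{t_1} + 2^{t_2}$$ such that $m_1 \geq m_2 \geq m_3 \geq 0$ and $t_1 \geq t_2 \geq 0$. Then $m_1 \leq 16$ and $t_1 \leq 10$. In particular, this equation has exactly $116$ solutions (with $m_1 \geq m_2 \geq m_3 \geq 0$ and $t_1 \geq t_2 \geq 0$).
   Context: $F_k$ denotes the $k$-th Fibonacci number: $F_0=0$, $F_1=1$, $F_{k+2}=F_{k+1}+F_k$ for $k\geq 0$. Here $\mathbb{N}$ includes $0$. *)

(* Defs.v *)
From mathcomp Require Import all_boot.
Set Implicit Arguments. Unset Strict Implicit. Unset Printing Implicit Defensive.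

Fixpoint fib (n : nat) : nat :=
  match n with
  | 0 => 0
  | S n' => match n' with
            | 0 => 1
            | S n'' => fib n' + fib n''
            end
  end.

Definition is_sol (m1 m2 m3 t1 t2 : nat) : bool :=
  [&& m3 <= m2, m2 <= m1, t2 <= t1 &
      fib m1 + fib m2 + fib m3 == 2 ^ t1 + 2 ^ t2].

(* Main.v *)
Require Import Defs.
From Stdlib Require Import NArith.
Set Warnings "-notation-overridden".
From mathcomp Require Import all_boot.
From mathcomp Require Import zify.

(** A solution with [t1 <= 12] has [m1 <= 20], so these are enumerated. There is
    no solution with [t1 >= 13], because such an equation has no solution modulo
    a suitable integer M. Since the Fibonacci numbers and the powers of 2 are
    periodic modulo the odd part of M, and [2 ^ t1] vanishes modulo 2^13, only
    finitely many residues of the exponents matter; [t2] is either one of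
    0, ..., 12 or at least 13, and in the second case [2 ^ t2] vanishes as well.
    The residues are sieved: the moduli [n] of the indices [mi] and [l] of the
    exponents [ti] grow by small factors, and after each enlargement the classes
    violating the equation modulo some q with Pisano period dividing [n] (and
    order of 2 dividing [l]) are discarded, until none is left.

    The bound 13 is forced by this method: congruences cannot tell apart
    positive and negative Fibonacci indices, and
    F_19 + F_9 + F_{-10} = 2^12 + 2^6. *)

Set Implicit Arguments. Unset Strict Implicit. Unset Printing Implicit Defensive.

(** * Fibonacci numbers and powers of 2 modulo q by doubling *)

(* Memo tables: the subtree reached along the binary expansion of [p], most
   significant bit first, carries the value at [p] of a function defined by
   doubling, so that consecutive evaluations share their prefixes. *)
Inductive trie (V : Type) := Leaf of V | Node of V & trie V & trie V.
Arguments Leaf {V}.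
Arguments Node {V}.

Definition root V (t : trie V) : V := match t with Leaf v => v | Node v _ _ => v end.

Fixpoint build V (f0 f1 : V -> V) (d : nat) (v : V) : trie V :=
  if d is d'.+1 then Node v (build f0 f1 d' (f0 v)) (build f0 f1 d' (f1 v)) else Leaf v.

Fixpoint descend V (f0 f1 : V -> V) (t : trie V) (p : positive) : trie V :=
  match p with
  | xH => t
  | xO p' => match descend f0 f1 t p' with Leaf v => Leaf (f0 v) | Node _ l _ => l end
  | xI p' => match descend f0 f1 t p' with Leaf v => Leaf (f1 v) | Node _ _ r => r end
  end.

(** The cap keeps a table below 2^13 nodes; past a leaf, [descend] goes on doubling directly. *)
Definition depth (n : N) : nat := minn (N.to_nat (N.size n)) 12.

(* The pair of residues of [F_(n-1)] and [F_n] is sent to the one for [2n]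
   by [fib0], and to the one for [2n+1] by [fib1]. *)
Definition fib0 (q : N) (v : N * N) : N * N :=
  let: (x, y) := v in ((x * x + y * y) mod q, (y * (2 * x + y)) mod q)%num.
Definition fib1 (q : N) (v : N * N) : N * N :=
  let: (x, y) := v in ((y * (2 * x + y)) mod q, (x * x + y * (2 * x + 2 * y)) mod q)%num.

Definition fib_mod (q : N) (d : nat) : N -> N :=
  let t := build (fib0 q) (fib1 q) d (0%num, 1%num) in
  fun i => if i is Npos p then (root (descend (fib0 q) (fib1 q) t p)).2 else 0%num.

Definition pow0 (q x : N) : N := ((x * x) mod q)%num.
Definition pow1 (q x : N) : N := ((2 * (x * x)) mod q)%num.

Definition pow2_mod (q : N) (d : nat) : N -> N :=
  let t := build (pow0 q) (pow1 q) d (2 mod q)%num in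
  fun i => if i is Npos p then root (descend (pow0 q) (pow1 q) t p) else (1 mod q)%num.

(** * The sieve on residue classes *)

Fixpoint lifts (k : nat) (n a : N) : seq N :=
  if k is k'.+1 then a :: lifts k' n (a + n)%num else [::].

(** For reduced arguments one conditional subtraction replaces a division. *)
Definition add_mod (q x y : N) : N :=
  (let s := x + y in if s <? q then s else s - q)%num.
Definition sub_mod (q x y : N) : N :=
  (if y <=? x then x - y else x + q - y)%num.

(* [State a b c t x u] stands for [m1 = a], [m2 = b], [m3 = c] modulo [n] and
   [t1 = t] modulo [l]; moreover [t2] equals [u] if [x] holds, and otherwise
   [t2 >= 13] and [t2 = u] modulo [l]. *)
Definition state : Type := (N * N * N * (N * bool * N))%type.
Definition State (a b c t : N) (x : bool) (u : N) : state := (a, b, c, (t, x, u)).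
Definition ra (s : state) := s.1.1.1.
Definition rb (s : state) := s.1.1.2.
Definition rc (s : state) := s.1.2.
Definition rt (s : state) := s.2.1.1.
Definition exact (s : state) := s.2.1.2.
Definition ru (s : state) := s.2.2.

Definition tabulate (f : N -> N) (s : seq N) := [seq (i, f i) | i <- s].

(* The equation is compared as [F_m1 + F_m2 = 2^t1 + 2^t2 - F_m3], so that the
   innermost loop only tests the equality of reduced residues. *)
Definition refine (q n l : N) (k j : nat) (F P : N -> N) (s : state) :=
  let T := tabulate P (lifts j l (rt s)) in
  let U := if exact s then tabulate (pow2_mod q 0) [:: ru s]
           else tabulate P (lifts j l (ru s)) in
  let C := tabulate F (lifts k n (rc s)) in
  let AB := [seq (x.1, y.1, add_mod q x.2 y.2)
            | x <- tabulate F (lifts k n (ra s)), y <- tabulate F (lifts k n (rb s))] in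
  let R := [seq (z.1, p, sub_mod q p.2 z.2)
           | p <- [seq (x.1, y.1, add_mod q x.2 y.2) | x <- T, y <- U], z <- C] in
  flatten [seq [seq State x.1.1 x.1.2 y.1.1 y.1.2.1.1 (exact s) y.1.2.1.2
               | y <- R & N.eqb x.2 y.2] | x <- AB].

(* Even moduli are divisors of 2^13, and only exponents at least 13 occur. *)
Definition pow2_res (q : N) (d : nat) : N -> N :=
  if N.even q then fun=> 0%num else pow2_mod q d.

(** The pair (F_0, F_1) recurs at index [n] modulo [q], so [n] is a multiple of the Pisano period;
    for odd [q], [l] is a multiple of the order of 2. *)
Definition valid (q n l : N) : bool :=
  [&& N.ltb 1 q, N.ltb 0 n, N.ltb 0 l, fib_mod q 0 n == 0%num, fib_mod q 0 (n + 1) == 1%num &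
    if N.even q then (2 ^ 13 mod q)%num == 0%num else pow2_mod q 0 l == 1%num].

Fixpoint sieve (steps : seq (N * N * N)) (n l : N) (S : seq state) : bool :=
  match steps with
  | [::] => nilp S
  | (k, j, q) :: steps' =>
      let n' := (n * k)%num in let l' := (l * j)%num in
      valid q n' l' &&
      let F := fib_mod q (depth n') in
      let P := pow2_res q (depth l') in
      sieve steps' n' l' (flatten [seq refine q n l (N.to_nat k) (N.to_nat j) F P s | s <- S])
  end.

(* By symmetry, only sorted residues modulo 24 are needed. *)
Definition init : seq state :=
  flatten [seq flatten [seq flatten [seq
    State a b c 0 false 0 :: [seq State a b c 0 true e | e <- lifts 13 1 0]
    | c <- lifts (N.to_nat b).+1 1 0] | b <- lifts (N.to_nat a).+1 1 0] | a <- lifts 24 1 0].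

(* A triple [(k, j, q)] multiplies [n] by [k] and [l] by [j], then filters
   modulo [q]. The list was found by experiment, keeping the number of
   surviving classes below 10^5. *)
Definition steps : seq (N * N * N) :=
  [:: (1,1,16); (1,6,9); (2,1,7); (1,1,32); (5,2,5); (1,5,61); (1,1,31); (1,1,41); (1,1,11);
   (1,2,241); (2,1,64); (1,10,1601); (2,1,128); (2,1,256); (1,4,641);
   (2,1,512); (2,1,1024); (1,8,15361); (2,1,2048); (2,1,4096); (2,1,8192); (1,2,61441)]%num.

(** * Correctness of the modular evaluation, and periods *)

Definition fibN (i : N) : N := N.of_nat (fib (N.to_nat i)).

Lemma fib_add (m n : nat) : fib (m + n.+1) = fib m * fib n + fib m.+1 * fib n.+1.
Proof.
elim: m n => [|m IHm] n; first by rewrite add0n mul0n mul1n.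
rewrite addSnnS IHm.
have -> : fib n.+2 = fib n.+1 + fib n by [].
have -> : fib m.+2 = fib m.+1 + fib m by [].
lia.
Qed.

Lemma fibN_add (m n : N) :
  fibN (m + (n + 1)) = (fibN m * fibN n + fibN (m + 1) * fibN (n + 1))%num.
Proof.
rewrite /fibN !N2Nat.inj_add -[N.to_nat 1]/1 !plusE !addn1 fib_add.
by rewrite -plusE -multE !Nat2N.inj_add !Nat2N.inj_mul.
Qed.

Fixpoint eval V (f0 f1 : V -> V) (v : V) (p : positive) : V :=
  match p with
  | xH => v
  | xO p' => f0 (eval f0 f1 v p')
  | xI p' => f1 (eval f0 f1 v p')
  end.

Lemma descend_build V (f0 f1 : V -> V) d v p :
  root (descend f0 f1 (build f0 f1 d v) p) = eval f0 f1 v p.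
Proof.
(* For the induction: the subtree reached is again a built table, of depth 0 beyond the leaves. *)
suff [d' ->]: exists d', descend f0 f1 (build f0 f1 d v) p = build f0 f1 d' (eval f0 f1 v p).
  by case: d'.
elim: p => [p [[|d'] /= ->]|p [[|d'] /= ->]|]; last by exists d.
- by exists 0.
- by exists d'.
- by exists 0.
- by exists d'.
Qed.

Lemma mod_addM q a b k : a = (b + k * q)%num -> (a mod q = b mod q)%num.
Proof. by move->; rewrite N.Div0.mod_add. Qed.

Lemma fib0E q x y : fib0 q (x mod q, y mod q)%num =
  ((x * x + y * y) mod q, (y * (2 * x + y)) mod q)%num.
Proof.
have := N.div_mod' x q; have := N.div_mod' y q.
set r := (x mod q)%num; set s := (y mod q)%num; set k := (x / q)%num; set h := (y / q)%num.
move=> -> ->; rewrite /fib0; congr pair; apply/esym.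
  (* With x = q k + r and y = q h + s, the witness is the difference of the two expressions divided
     by q. *)
  by apply: (@mod_addM _ _ _ (k * (q * k + 2 * r) + h * (q * h + 2 * s))); ring.
by apply: (@mod_addM _ _ _ (h * (2 * (q * k + r) + q * h + s) + s * (2 * k + h))); ring.
Qed.

Lemma fib1E q x y : fib1 q (x mod q, y mod q)%num =
  ((y * (2 * x + y)) mod q, (x * x + y * (2 * x + 2 * y)) mod q)%num.
Proof.
have := N.div_mod' x q; have := N.div_mod' y q.
set r := (x mod q)%num; set s := (y mod q)%num; set k := (x / q)%num; set h := (y / q)%num.
move=> -> ->; rewrite /fib1; congr pair; apply/esym.
  by apply: (@mod_addM _ _ _ (h * (2 * (q * k + r) + q * h + s) + s * (2 * k + h))); ring.
by apply: (@mod_addM _ _ _ (k * (q * k + 2 * r) +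
   (h * (2 * (q * k + r) + 2 * (q * h + s)) + s * (2 * k + 2 * h)))); ring.
Qed.

Lemma fibN_succ n : fibN (n + 1 + 1) = (fibN (n + 1) + fibN n)%num.
Proof.
rewrite /fibN -Nat2N.inj_add !N2Nat.inj_add !plusE -[N.to_nat 1]/1 !addn1.
by rewrite -[fib (N.to_nat n).+2]/(fib (N.to_nat n).+1 + fib (N.to_nat n)) -plusE.
Qed.

(** The doubling rules are the addition formula at equal or consecutive indices. *)
Lemma eval_fib q p : (1 < q)%num ->
  eval (fib0 q) (fib1 q) (0, 1)%num p =
  (fibN (N.pos p - 1) mod q, fibN (N.pos p) mod q)%num.
Proof.
move=> q1; elim: p => [p IH|p IH|]; last first.
- rewrite /eval -[(N.pos 1 - 1)%num]/0%num -[fibN 0]/0%num -[fibN _]/1%num.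
  by rewrite !N.mod_small //; lia.
- rewrite [LHS]/= IH fib0E.
  have [n en] : exists n, N.pos p = (n + 1)%num by exists (N.pos p - 1)%num; lia.
  have -> : (N.pos p~0 - 1 = n + (n + 1))%num by lia.
  have -> : N.pos p~0 = (n + 1 + (n + 1))%num by lia.
  have -> : (N.pos p - 1 = n)%num by lia.
  rewrite en !fibN_add fibN_succ.
  by congr pair; congr N.modulo; ring.
- rewrite [LHS]/= IH fib1E.
  have [n en] : exists n, N.pos p = (n + 1)%num by exists (N.pos p - 1)%num; lia.
  have -> : (N.pos p~1 - 1 = n + 1 + (n + 1))%num by lia.
  have -> : N.pos p~1 = (n + 1 + (n + 1 + 1))%num by lia.
  have -> : (N.pos p - 1 = n)%num by lia.
  rewrite en !fibN_add fibN_succ.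
  by congr pair; congr N.modulo; ring.
Qed.

Lemma fib_modE q d i : (1 < q)%num -> fib_mod q d i = (fibN i mod q)%num.
Proof.
move=> q1; case: i => [|p]; first by rewrite -[fibN _]/0%num N.mod_small //; lia.
by rewrite /fib_mod descend_build eval_fib.
Qed.

Lemma pow2_modE q d i : pow2_mod q d i = (2 ^ i mod q)%num.
Proof.
case: i => [|p] //; rewrite /pow2_mod descend_build.
elim: p => [p IH|p IH|] //; rewrite [LHS]/= IH.
  have -> : N.pos p~1 = (1 + (N.pos p + N.pos p))%num by lia.
  rewrite /pow1 !N.pow_add_r -[RHS]N.Div0.mul_mod_idemp_r.
  by rewrite -[LHS]N.Div0.mul_mod_idemp_r -N.Div0.mul_mod.
have -> : N.pos p~0 = (N.pos p + N.pos p)%num by lia.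
by rewrite /pow0 -N.Div0.mul_mod N.pow_add_r.
Qed.

(** Stronger than congruence: the representative [a] never exceeds [m], so no subtraction of
    exponents or indices arises. *)
Definition rep (n a m : N) : Prop := exists j, m = (a + j * n)%num.

Lemma rep_lifts k n a m : 0 < k -> rep n a m ->
  exists2 a', a' \in lifts k n a & rep (n * N.of_nat k) a' m.
Proof.
move=> k0 [j ->].
(* Dividing [j] by [k], the remainder selects the lift and the quotient is the new multiplier. *)
have [h [r [rk ->]]] : exists h r, (r < N.of_nat k)%num /\ (j = h * N.of_nat k + r)%num.
  exists (j / N.of_nat k)%num, (j mod N.of_nat k)%num; split.
    by apply: N.mod_upper_bound; lia.
  by rewrite N.mul_comm; apply: N.div_mod'.
exists (a + r * n)%num; last by exists h; ring.
have [i ei] : exists i, r = N.of_nat i by exists (N.to_nat r); rewrite N2Nat.id.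
have {rk} : i < k by lia.
rewrite {}ei; elim: k i a {k0} => // k IH [|i] a ik.
  by rewrite -[N.of_nat 0]/0%num N.mul_0_l N.add_0_r mem_head.
rewrite /= inE; apply/orP; right.
have -> : (a + N.of_nat i.+1 * n = a + n + N.of_nat i * n)%num by lia.
exact: IH.
Qed.

Lemma fibN_period q n a m : (1 < q)%num -> fib_mod q 0 n == 0%num ->
  fib_mod q 0 (n + 1) == 1%num -> rep n a m -> (fibN m mod q = fibN a mod q)%num.
Proof.
move=> q1; rewrite !fib_modE // => /eqP f0 /eqP f1 [j ->].
elim/N.peano_ind: j => [|j <-]; first by rewrite N.mul_0_l N.add_0_r.
set b := (a + j * n)%num.
have -> : (a + N.succ j * n = n + b)%num by lia.
(* The addition formula needs its second index positive, so [b = 0] is treated apart. *)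
case: (N.eq_dec b 0) => [->|b0]; first by rewrite N.add_0_r f0 -[fibN 0]/0%num N.mod_small //; lia.
have [c ->] : exists c, b = (c + 1)%num by exists (b - 1)%num; lia.
rewrite fibN_add N.Div0.add_mod N.Div0.mul_mod f0 N.mul_0_l N.Div0.mod_0_l N.add_0_l.
by rewrite N.Div0.mod_mod N.Div0.mul_mod f1 N.mul_1_l !N.Div0.mod_mod.
Qed.

Lemma pow2_period q n a m : pow2_mod q 0 n == 1%num ->
  rep n a m -> (2 ^ m mod q = 2 ^ a mod q)%num.
Proof.
rewrite !pow2_modE // => /eqP p1 [j ->].
elim/N.peano_ind: j => [|j <-]; first by rewrite N.mul_0_l N.add_0_r.
have -> : (a + N.succ j * n = n + (a + j * n))%num by lia.
by rewrite N.pow_add_r N.Div0.mul_mod p1 N.mul_1_l N.Div0.mod_mod.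
Qed.

Lemma pow2_large q t : (13 <= t)%num -> (2 ^ 13 mod q = 0)%num -> (2 ^ t mod q = 0)%num.
Proof.
move=> t13 q13; have -> : t = (13 + (t - 13))%num by lia.
by rewrite N.pow_add_r N.Div0.mul_mod q13 N.mul_0_l N.Div0.mod_0_l.
Qed.

(** * Soundness of the sieve *)

Lemma add_modE q x y : (x < q)%num -> (y < q)%num ->
  add_mod q x y = ((x + y) mod q)%num.
Proof.
move=> xq yq; rewrite /add_mod; case: N.ltb_spec => h; first by rewrite N.mod_small.
by apply: (N.mod_unique _ _ 1); lia.
Qed.

Lemma sub_modE q x y z : (x < q)%num -> (y < q)%num -> (z < q)%num ->
  ((x + y) mod q = z)%num -> x = sub_mod q z y.
Proof.
move=> xq yq zq; rewrite -add_modE // /add_mod /sub_mod.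
by case: N.ltb_spec => h <-; case: N.leb_spec => h'; lia.
Qed.

Definition represents (n l : N) (s : state) (m1 m2 m3 t1 t2 : N) : Prop :=
  [/\ rep n (ra s) m1, rep n (rb s) m2, rep n (rc s) m3, rep l (rt s) t1 &
      if exact s then t2 = ru s else (13 <= t2)%num /\ rep l (ru s) t2].

Lemma valid_fib q n l d a m : valid q n l -> rep n a m ->
  fib_mod q d a = (fibN m mod q)%num.
Proof.
case/and5P=> /N.ltb_spec0 q1 _ _ f0 /andP[f1 _] r; rewrite fib_modE //.
exact/esym/(fibN_period q1 f0 f1 r).
Qed.

Lemma valid_pow2 q n l d a t : valid q n l -> (13 <= t)%num -> rep l a t ->
  pow2_res q d a = (2 ^ t mod q)%num.
Proof.
case/and5P=> _ _ _ _ /andP[_]; rewrite /pow2_res; case: N.even => [/eqP q13|p1] t13 r.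
  by rewrite pow2_large.
by rewrite pow2_modE (pow2_period p1 r).
Qed.

(** The lifts representing a true solution pass the filter because the equation also holds modulo
    [q]. *)
Lemma refine_sound q n l k j d e s m1 m2 m3 t1 t2 :
  let n' := (n * k)%num in let l' := (l * j)%num in
  valid q n' l' ->
  (fibN m1 + fibN m2 + fibN m3 = 2 ^ t1 + 2 ^ t2)%num -> (13 <= t1)%num ->
  represents n l s m1 m2 m3 t1 t2 ->
  exists2 s', s' \in refine q n l (N.to_nat k) (N.to_nat j) (fib_mod q d) (pow2_res q e) s &
    represents n' l' s' m1 m2 m3 t1 t2.
Proof.
move=> n' l' V eqn t13 [r1 r2 r3 rt1 rt2].
case/and5P: (V) => /N.ltb_spec0 q1 /N.ltb_spec0 n0 /N.ltb_spec0 l0 _ _.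
have k0 : 0 < N.to_nat k by move: n0; rewrite /n'; lia.
have j0 : 0 < N.to_nat j by move: l0; rewrite /l'; lia.
have [a a_in] := rep_lifts k0 r1; rewrite N2Nat.id => ra'.
have [b b_in] := rep_lifts k0 r2; rewrite N2Nat.id => rb'.
have [c c_in] := rep_lifts k0 r3; rewrite N2Nat.id => rc'.
have [t t_in] := rep_lifts j0 rt1; rewrite N2Nat.id => rt'.
set U := if exact s then tabulate (pow2_mod q 0) [:: ru s]
         else tabulate (pow2_res q e) (lifts (N.to_nat j) l (ru s)).
(* An exact [t2] may be below 13, so its power is computed directly even when [q] is even. *)
have [u u_in ru'] : exists2 u, (u, 2 ^ t2 mod q)%num \in U &
    if exact s then t2 = u else (13 <= t2)%num /\ rep l' u t2.
  rewrite /U; case: (exact s) rt2 => [->|[t213 rt2]].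
    by exists (ru s); rewrite // /tabulate map_cons pow2_modE mem_head.
  have [u u_in] := rep_lifts j0 rt2; rewrite N2Nat.id => ru'.
  by exists u => //; apply/mapP; exists u; rewrite // (valid_pow2 _ V t213 ru').
have lt_mod x : (x mod q < q)%num by apply: N.mod_upper_bound; lia.
exists (State a b c t (exact s) u); last by split.
apply/flattenP; eexists.
  apply/mapP; exists (a, b, add_mod q (fibN m1 mod q) (fibN m2 mod q)) => //.
  apply/allpairsP; exists ((a, fibN m1 mod q), (b, fibN m2 mod q))%num; split=> //.
    by apply/mapP; exists a; rewrite // (valid_fib _ V ra').
  by apply/mapP; exists b; rewrite // (valid_fib _ V rb').
apply/mapP; exists (c, (t, u, add_mod q (2 ^ t1 mod q) (2 ^ t2 mod q)),
   sub_mod q (add_mod q (2 ^ t1 mod q) (2 ^ t2 mod q)) (fibN m3 mod q))%num => //.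
rewrite mem_filter; apply/andP; split.
  apply/N.eqb_spec; rewrite /= !add_modE //; apply: sub_modE => //.
  by rewrite -(N.Div0.add_mod (fibN m1)) -(N.Div0.add_mod (2 ^ t1)) -N.Div0.add_mod eqn.
apply/allpairsP.
exists ((t, u, add_mod q (2 ^ t1 mod q) (2 ^ t2 mod q)), (c, fibN m3 mod q))%num; split=> //.
  apply/allpairsP; exists ((t, 2 ^ t1 mod q), (u, 2 ^ t2 mod q))%num; split=> //.
  by apply/mapP; exists t; rewrite // (valid_pow2 _ V t13 rt').
by apply/mapP; exists c; rewrite // (valid_fib _ V rc').
Qed.

(** Each step hands a represented class on to one of its refinements, which contradicts the final
    list being empty. *)
Lemma sieve_sound st n l S m1 m2 m3 t1 t2 :
  (fibN m1 + fibN m2 + fibN m3 = 2 ^ t1 + 2 ^ t2)%num -> (13 <= t1)%num ->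
  sieve st n l S -> forall s, s \in S -> ~ represents n l s m1 m2 m3 t1 t2.
Proof.
move=> eqn t13; elim: st n l S => [|[[k j] q] st IH] n l S /=.
  by case: S.
case/andP=> V sv s sS rs.
have [s' s'_in rs'] := refine_sound (depth (n * k)) (depth (l * j)) V eqn t13 rs.
apply: (IH _ _ _ sv s') rs'.
by apply/flattenP; eexists; last exact: s'_in; apply: map_f.
Qed.

(** * Exclusion of t1 >= 13 *)

Lemma mem_lifts1 k i : (i < N.of_nat k)%num -> i \in lifts k 1 0.
Proof.
have [h ->] : exists h, i = N.of_nat h by exists (N.to_nat i); rewrite N2Nat.id.
suff H k' b : h < k' -> (b + N.of_nat h)%num \in lifts k' 1 b.
  by move=> hk; apply: (H k 0%num); lia.
elim: k' h b {i k} => // k IH [|h] b hk /=; first by rewrite N.add_0_r mem_head.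
have -> : (b + N.of_nat h.+1 = b + 1 + N.of_nat h)%num by lia.
by rewrite inE IH ?orbT.
Qed.

Lemma init_sound a b c x u : (a < 24)%num -> (b <= a)%num -> (c <= b)%num ->
  (if x then u < 13 else u = 0)%num -> State a b c 0 x u \in init.
Proof.
move=> a24 ba cb xu; rewrite /init.
apply/flatten_mapP; exists a; first by apply: mem_lifts1; lia.
apply/flatten_mapP; exists b; first by apply: mem_lifts1; lia.
apply/flatten_mapP; exists c; first by apply: mem_lifts1; lia.
case: x xu => [u13|->]; last by rewrite mem_head.
by rewrite inE; apply/orP; right; apply/mapP; exists u => //; apply: mem_lifts1; lia.
Qed.

(** The start 24 is the Pisano period of 16 and of 9, the first two moduli. The virtual machine runs
    the sieve once, at [Qed]. *)
Lemma sieve_ok : sieve steps 24 1 init.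
Proof. vm_cast_no_check (erefl true). Qed.

Lemma no_large_solution_sorted m1 m2 m3 t1 t2 :
  (m3 mod 24 <= m2 mod 24)%num -> (m2 mod 24 <= m1 mod 24)%num -> (13 <= t1)%num ->
  (fibN m1 + fibN m2 + fibN m3 <> 2 ^ t1 + 2 ^ t2)%num.
Proof.
move=> m32 m21 t13 eqn.
have r24 m : rep 24 (m mod 24) m.
  by exists (m / 24)%num; rewrite [LHS](N.div_mod' m 24); lia.
have r1 t : rep 1 0 t by exists t; lia.
have m24 : (m1 mod 24 < 24)%num by apply: N.mod_upper_bound.
case: (N.ltb_spec t2 13) => t2_13.
  apply: (sieve_sound eqn t13 sieve_ok (@init_sound _ _ _ true t2 m24 m21 m32 t2_13)).
  by split; [apply: r24 | apply: r24 | apply: r24 | apply: r1 | ].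
apply: (sieve_sound eqn t13 sieve_ok (@init_sound _ _ _ false 0 m24 m21 m32 erefl)).
by split; [apply: r24 | apply: r24 | apply: r24 | apply: r1 | split; last apply: r1].
Qed.

(** The equation is symmetric in the indices, so they can be permuted until their residues modulo 24
    are sorted. *)
Lemma no_large_solution m1 m2 m3 t1 t2 : (13 <= t1)%num ->
  (fibN m1 + fibN m2 + fibN m3 <> 2 ^ t1 + 2 ^ t2)%num.
Proof.
move=> t13 eqn; have S a b c := @no_large_solution_sorted a b c t1 t2.
case: (N.le_ge_cases (m1 mod 24) (m2 mod 24)) => h12;
case: (N.le_ge_cases (m1 mod 24) (m3 mod 24)) => h13;
case: (N.le_ge_cases (m2 mod 24) (m3 mod 24)) => h23;
first [ by apply: (S m1 m2 m3); rewrite // -eqn; lia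
      | by apply: (S m1 m3 m2); rewrite // -eqn; lia
      | by apply: (S m2 m1 m3); rewrite // -eqn; lia
      | by apply: (S m2 m3 m1); rewrite // -eqn; lia
      | by apply: (S m3 m1 m2); rewrite // -eqn; lia
      | by apply: (S m3 m2 m1); rewrite // -eqn; lia ].
Qed.

(** * Enumeration of the small solutions *)

Lemma fib_leq m n : m <= n -> fib m <= fib n.
Proof.
move/subnK<-; elim: (n - m) => // d IH; apply: leq_trans IH _.
rewrite addSn; case: (d + m) => // k.
by rewrite -[fib k.+2]/(fib k.+1 + fib k) leq_addr.
Qed.

Lemma of_nat_expn t : N.of_nat (2 ^ t) = (2 ^ N.of_nat t)%num.
Proof. by elim: t => // t IH; rewrite expnS Nat2N.inj_succ N.pow_succ_r' -IH; lia. Qed.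

Lemma small_solution m1 m2 m3 t1 t2 :
  fib m1 + fib m2 + fib m3 = 2 ^ t1 + 2 ^ t2 -> t2 <= t1 -> t1 <= 12 /\ m1 <= 20.
Proof.
move=> eqn t21.
have t12 : t1 <= 12.
  case: (leqP t1 12) => // t13.
  have /= := @no_large_solution (N.of_nat m1) (N.of_nat m2) (N.of_nat m3) (N.of_nat t1) (N.of_nat t2).
  case; first by lia.
  by rewrite /fibN !Nat2N.id -!of_nat_expn -!Nat2N.inj_add !plusE eqn.
split=> //; case: (leqP m1 20) => // m21.
(* F_21 = 10946 exceeds 2^13, which bounds the right-hand side as t2 <= t1 <= 12. *)
have f21 := fib_leq m21.
have p1 : 2 ^ t1 <= 2 ^ 12 by rewrite leq_exp2l.
have p2 : 2 ^ t2 <= 2 ^ 12 by rewrite leq_exp2l // (leq_trans t21).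
have : N.of_nat (fib 21) = 10946%num by [].
have : N.of_nat (2 ^ 12) = 4096%num by [].
lia.
Qed.

(** The modulus 2^14 exceeds F_20 = 6765, so up to index 20 the residues are the Fibonacci numbers
    themselves, in binary. *)
Definition fib_table : N -> N := fib_mod 16384 5.

Lemma fib_tableE m : m <= 20 -> fib_table (N.of_nat m) = N.of_nat (fib m).
Proof.
move=> m20; rewrite /fib_table fib_modE // /fibN Nat2N.id N.mod_small //.
have := fib_leq m20; have : N.of_nat (fib 20) = 6765%num by [].
lia.
Qed.

Definition triples : seq (nat * nat * nat) :=
  flatten [seq flatten [seq [seq (a, b, c) | c <- iota 0 b.+1] | b <- iota 0 a.+1]
          | a <- iota 0 21].

Definition pairs : seq (nat * nat) :=
  flatten [seq [seq (a, b) | b <- iota 0 a.+1] | a <- iota 0 13].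

Definition solutions : seq (nat * nat * nat * nat * nat) :=
  let S := [seq (x, fib_table (N.of_nat x.1.1) + fib_table (N.of_nat x.1.2)
                    + fib_table (N.of_nat x.2))%num | x <- triples] in
  let T := [seq (y, 2 ^ N.of_nat y.1 + 2 ^ N.of_nat y.2)%num | y <- pairs] in
  flatten [seq [seq (x.1, y.1.1, y.1.2) | y <- T & N.eqb x.2 y.2] | x <- S].

Lemma mem_triples a b c : ((a, b, c) \in triples) = [&& c <= b, b <= a & a <= 20].
Proof.
apply/flatten_mapP/and3P => [[i]|[cb ba a20]].
  rewrite mem_iota => /andP[_ i21] /flatten_mapP[j]; rewrite mem_iota => /andP[_ ji].
  by case/mapP=> k; rewrite mem_iota => /andP[_ kj] [-> -> ->].
exists a; rewrite ?mem_iota //; apply/flatten_mapP; exists b; rewrite ?mem_iota //.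
by apply/mapP; exists c; rewrite ?mem_iota.
Qed.

Lemma mem_pairs a b : ((a, b) \in pairs) = (b <= a) && (a <= 12).
Proof.
apply/flatten_mapP/andP => [[i]|[ba a12]].
  by rewrite mem_iota => /andP[_ i13] /mapP[j]; rewrite mem_iota => /andP[_ ji] [-> ->].
by exists a; rewrite ?mem_iota //; apply/mapP; exists b; rewrite ?mem_iota.
Qed.

Lemma mem_solutions m1 m2 m3 t1 t2 :
  ((m1, m2, m3, t1, t2) \in solutions) = is_sol m1 m2 m3 t1 t2.
Proof.
have eqnE : m1 <= 20 -> m2 <= m1 -> m3 <= m2 ->
  N.eqb (fib_table (N.of_nat m1) + fib_table (N.of_nat m2) + fib_table (N.of_nat m3))
        (2 ^ N.of_nat t1 + 2 ^ N.of_nat t2) = (fib m1 + fib m2 + fib m3 == 2 ^ t1 + 2 ^ t2).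
  move=> a b c; have b' := leq_trans b a; rewrite !fib_tableE // ?(leq_trans c) //.
  rewrite -!of_nat_expn -!Nat2N.inj_add !plusE.
  by apply/N.eqb_spec/eqP => [/Nat2N.inj|->].
apply/flatten_mapP/idP => [[_ /mapP[[[a b] c] x_in ->] /mapP[y]]|/and4P[m32 m21 t21 eqn]].
  rewrite mem_filter => /andP[+ /mapP[[t u] y_in ey]].
  rewrite {}ey => /= + [ea eb ec et eu]; subst a b c t u.
  move: x_in y_in; rewrite mem_triples mem_pairs => /and3P[m32 m21 m1_20] /andP[t21 _].
  by rewrite eqnE // /is_sol => ->; rewrite m32 m21 t21.
have [t12 m20] := small_solution (eqP eqn) t21.
have x_in : (m1, m2, m3) \in triples by rewrite mem_triples m32 m21.
eexists; first exact: map_f x_in.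
apply/mapP; exists (t1, t2, 2 ^ N.of_nat t1 + 2 ^ N.of_nat t2)%num => //.
rewrite mem_filter eqnE // eqn; apply/mapP; exists (t1, t2) => //.
by rewrite mem_pairs t21.
Qed.

(** Inspecting the complete list sharpens the bounds 20 and 12 to 16 and 10. *)
Lemma solutions_ok : [&& size solutions == 116, uniq solutions &
  all (fun x => (x.1.1.1.1 <= 16) && (x.1.2 <= 10)) solutions].
Proof. vm_cast_no_check (erefl true). Qed.

Theorem theorem1p2 :
  (forall m1 m2 m3 t1 t2 : nat, is_sol m1 m2 m3 t1 t2 -> m1 <= 16 /\ t1 <= 10) /\
  #|[set x : 'I_17 * 'I_17 * 'I_17 * 'I_11 * 'I_11 |
       is_sol x.1.1.1.1 x.1.1.1.2 x.1.1.2 x.1.2 x.2]| = 116.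
Proof.
(* Abstracting the list keeps it from being unfolded again. *)
move: mem_solutions solutions_ok; move: solutions => S mem_S.
case/and3P=> /eqP size_S uniq_S /allP bound_S.
have bound m1 m2 m3 t1 t2 : is_sol m1 m2 m3 t1 t2 -> m1 <= 16 /\ t1 <= 10.
  by rewrite -mem_S => /bound_S /andP.
split=> //.
pose g (x : 'I_17 * 'I_17 * 'I_17 * 'I_11 * 'I_11) : nat * nat * nat * nat * nat :=
  (val x.1.1.1.1, val x.1.1.1.2, val x.1.1.2, val x.1.2, val x.2).
have g_inj : injective g.
  move=> [[[[a b] c] t] u] [[[[a' b'] c'] t'] u'] [].
  by do 5![move/val_inj->].
(* The image of the set under [g] and [S] are duplicate-free with the same members, hence of equal
   size. *)
rewrite cardE -(size_map g) -[RHS]size_S; apply/perm_size/uniq_perm => //.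
  by rewrite map_inj_uniq ?enum_uniq.
move=> [[[[m1 m2] m3] t1] t2]; rewrite mem_S; apply/mapP/idP => [[x]|sol].
  by rewrite mem_enum inE => x_sol [-> -> -> -> ->].
have [m1_16 t1_10] := bound _ _ _ _ _ sol.
case/and4P: (sol) => m32 m21 t21 _.
have m2_16 := leq_trans m21 m1_16.
(* By the ordering, the bounds on [m1] and [t1] bound all entries, so [inord] preserves their
   values. *)
exists (inord m1, inord m2, inord m3, inord t1, inord t2);
  last by rewrite /g /= !inordK // ltnS ?(leq_trans m32) ?(leq_trans t21).
by rewrite mem_enum inE /= !inordK // ltnS ?(leq_trans m32) ?(leq_trans t21).
Qed.
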